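(* Let $k,n$ be positive integers with $2k<n$, let $q$ be a prime power with $q\ge nk$, let $\gamma$ be a primitive element of $\mathbb{F}_q$, and let $\mathcal{F}_{n,k}=\{S_1,\dots,S_m\}$, $m=q^{n-2k}$, be the family of subspaces of $\mathbb{F}_q^n$ constructed in the context. Then $\mathcal{F}_{n,k}$ is a partial spread of $k$-dimensional subspaces in $\mathbb{F}_q^n$. Moreover, for $k=1$ and $k=2$, the family $\mathcal{F}_{n,k}$ is $[n,k,L_{n,k}]_q$-AAD with $L_{n,1}=n-1$ and $L_{n,2}=1+2(n-2)(2n-5)$.
   Context: A partial spread of $k$-dimensional subspaces (partial $k$-spread) in $\mathbb{F}_q^n$ is a collection of $k$-dimensional linear subspaces with pairwise trivial intersection (i.e. equal to $\{0\}$). For $u\in\mathbb{F}_q^n$ and a subspace $S$, $u+S=\{u+v: v\in S\}$. For positive integers $k,n$ with $2k<n$, a family $\mathcal{F}$ of $k$-dimensional linear subspaces of $\mathbb{F}_q^n$ is $L$-almost affinely disjoint, written $[n,k,L]_q$-AAD, if (1) $\mathcal{F}$ is a partial $k$-spread of $\mathbb{F}_q^n$, and (2) for every $S\in\mathcal{F}$ and every $u\in\mathbb{F}_q^n\setminus S$, the affine subspace $u+S$ intersects (has nonempty intersection with) at most $L$ subspaces from $\mathcal{F}$. Construction of $\mathcal{F}_{n,k}$. Let $q\ge nk$, $m=q^{n-2k}$, and $\gamma$ a primitive element of $\mathbb{F}_q$. Let $\mathcal{C}\subseteq\mathbb{F}_q^{n-k-1}$ be the $[n-k-1,n-2k,k]_q$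 Reed–Solomon code (length $n-k-1$, dimension $n-2k$, minimum distance $k$) with the $(k-1)\times(n-k-1)$ parity-check matrix whose entry in row $t\in\{1,\dots,k-1\}$ and column $p\in\{1,\dots,n-k-1\}$ is $\gamma^{(p-1)(t-1)}$, that is, $\mathcal{C}=\{x\in\mathbb{F}_q^{n-k-1}:\sum_{p=1}^{n-k-1}\gamma^{(p-1)(t-1)}x_p=0 \text{ for all } t=1,\dots,k-1\}$ (for $k=1$, there is no constraint and $\mathcal{C}=\mathbb{F}_q^{n-2}$). Let $c_1,\dots,c_m$ be the $m=q^{n-2k}$ distinct codewords of $\mathcal{C}$. For $j\in\{1,\dots,k\}$ define $\Gamma_j:\mathbb{F}_q^{n-k-1}\to\mathbb{F}_q^{n-k-1}$ and $h_j:\mathbb{F}_q^{n-k-1}\to\mathbb{F}_q$ by $$\Gamma_j(x)=\big(\gamma^{j-1}x_1,\ \gamma^{2(j-1)}x_2,\ \dots,\ \gamma^{(n-k-1)(j-1)}x_{n-k-1}\big),\qquad h_j(x)=\sum_{p=1}^{n-k-1}x_p^{(j-1)(n-k-1)+p+1}.$$ For $i\in\{1,\dots,m\}$ and $j\in\{1,\dots,k\}$ let $v_{i,j}=(e_j,\ \Gamma_j(c_i),\ h_j(c_i))\in\mathbb{F}_q^{n}$ (concatenation), where $e_j$ is the unit vector of length $k$ with a one in position $j$. Let $S_i$ be the span of $v_{i,1},\dots,v_{i,k}$, and $\mathcal{F}_{n,k}=\{S_1,\dots,S_m\}$. *)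

(* Defs.v *)
From HB Require Import structures.
From mathcomp Require Import all_boot all_order all_algebra.
From mathcomp Require Import finmap.
Set Implicit Arguments. Unset Strict Implicit. Unset Printing Implicit Defensive.
Import GRing.Theory.
Local Open Scope ring_scope.

Section AlmostAffinelyDisjoint.
Variables (F : finFieldType) (n : nat).
Implicit Types (S T : {vspace 'rV[F]_n}) (A : {fset {vspace 'rV[F]_n}}).

Definition partial_spread (k : nat) A : Prop :=
  (forall S, S \in A -> \dim S = k) /\
  (forall S T, S \in A -> T \in A -> S != T -> (S :&: T = 0)%VS).

Definition affine_meets (u : 'rV[F]_n) S T : bool :=
  [exists v : 'rV[F]_n, (v \in S) && (u + v \in T)].

Definition almost_affinely_disjoint (k L : nat) A : Prop :=
  partial_spread k A /\
  forall S u, S \in A -> u \notin S ->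
    (#|` [fset T in A | affine_meets u S T]%fset| <= L)%N.

End AlmostAffinelyDisjoint.

(* Ordinals start at 0: the row t, column p and index j below stand for the   *)
(* t+1-st row, p+1-st column and j+1-st index when counting from 1.           *)
Section Construction.
Variables (F : finFieldType) (gamma : F) (n k : nat).

Definition code_length : nat := (n - k - 1)%N.

Definition parity_check : 'M[F]_(k - 1, code_length) :=
  \matrix_(t, p) gamma ^+ (p * t).

Definition RS_code : {set 'rV[F]_code_length} :=
  [set x | parity_check *m x^T == 0].

Definition Gamma (j : 'I_k) (x : 'rV[F]_code_length) : 'rV[F]_code_length :=
  \row_p (gamma ^+ (p.+1 * j) * x 0 p).

Definition h (j : 'I_k) (x : 'rV[F]_code_length) : F :=
  \sum_p x 0 p ^+ (j * code_length + p.+1 + 1).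

Lemma concat_length : (2 * k < n)%N -> (k + (code_length + 1) = n)%N.
Proof.
move=> lt2kn; have ltkn : (k < n)%N by apply: leq_ltn_trans lt2kn; rewrite leq_pmull.
by rewrite /code_length subnK ?subn_gt0 // subnKC // ltnW.
Qed.

(* The concatenation (e_j, Gamma_j c, h_j c). Its length is only propositionally *)
(* n (by concat_length); conform_mx performs the cast, and the default 0 is      *)
(* never returned when 2k < n.                                                   *)
Definition generator (j : 'I_k) (c : 'rV[F]_code_length) : 'rV[F]_n :=
  conform_mx 0 (row_mx (delta_mx 0 j) (row_mx (Gamma j c) (const_mx (h j c) : 'rV_1))).

Definition codeword_space (c : 'rV[F]_code_length) : {vspace 'rV[F]_n} :=
  <<[seq generator j c | j : 'I_k]>>%VS.

Definition AAD_family : {fset {vspace 'rV[F]_n}} :=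
  [fset codeword_space c | c in RS_code]%fset.

End Construction.

(* Main.v *)
(* A vector of S_c is (a, Gamma_a c, h_a c), where a lists its coefficients on   *)
(* the generators and Gamma_a multiplies the p-th entry by A(gamma^p), A being   *)
(* the polynomial of degree < k with coefficients a. As nonzero codewords have   *)
(* weight >= k, Gamma_a x = 0 forces a = 0 or x = 0; hence the S_c are           *)
(* distinct and meet trivially.                                                  *)
(*   Modulo S_c we may take u = (0, w, z); then u + S_c meets S_d iff for some a *)
(* w = Gamma_a (d - c) and z = h_a d - h_a c. If the direction of a is fixed,    *)
(* then d runs over a line c + F y, and the condition on z is a nonzero          *)
(* polynomial equation of degree at most k (n - k - 1) + 1 along that line.      *)
(* For k = 1 there is one direction. For k = 2 the directions are (1, 0) and     *)
(* (t, 1), and the parity check on d - c says that t is a root of a nonzero      *)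
(* polynomial of degree < n - 3, so that at most (n - 3) (2 n - 5) of the S_d    *)
(* are met.                                                                      *)
Require Import Defs.
From HB Require Import structures.
From mathcomp Require Import all_boot all_order all_algebra.
From mathcomp Require Import mxabelem.
From mathcomp Require Import finmap.
From mathcomp Require Import zify ring.
Set Implicit Arguments. Unset Strict Implicit. Unset Printing Implicit Defensive.
Import GRing.Theory.
Local Open Scope ring_scope.

(** Write N = n - k - 1. A Vandermonde argument ([orthogonal_powers_support]) gives nonzero
    codewords weight at least k, and a polynomial of degree < k with k roots vanishes, so for a != 0
    [gamma_part a] is injective on the code ([gamma_part_eq0]); the spread property follows. For
    translates, [affine_meets_encode] reduces u to an offset (w, z), [card_direction_set] bounds the
    S_d met along one direction of a by k N + 1, and [almost_affinely_disjoint_directions]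
    multiplies this by the number of directions. For k = 2, [card_poles_lt] leaves at most N
    directions. *)

(** * Casts, root counting and Vandermonde arguments *)

Lemma mulmx_castr (R : pzRingType) m p n n' (e : n = n')
    (A : 'M[R]_(m, p)) (B : 'M[R]_(p, n)) :
  A *m castmx (erefl p, e) B = castmx (erefl m, e) (A *m B).
Proof. by case: n' / e; rewrite !castmx_id. Qed.

Lemma card_roots_lt (F : finFieldType) (p : {poly F}) :
  p != 0 -> (#|[set t | root p t]| < size p)%N.
Proof.
move=> p0; rewrite cardE; apply: max_poly_roots p0 _ (enum_uniq _).
by apply/allP => t; rewrite mem_enum inE.
Qed.

Lemma castmxD (V : nmodType) m n n' (e : n = n') (A B : 'M[V]_(m, n)) :
  castmx (erefl m, e) (A + B) = castmx (erefl m, e) A + castmx (erefl m, e) B.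
Proof. by case: n' / e; rewrite !castmx_id. Qed.

Lemma size_linear_exp (F : fieldType) (c y : F) e :
  (size ((c%:P + y *: 'X) ^+ e)%R <= e.+1)%N.
Proof.
apply: leq_trans (size_poly_exp_leq _ _) _; rewrite ltnS -[leqRHS]mul1n leq_mul2r.
rewrite -subn1 leq_subLR (leq_trans (size_polyD _ _)) ?orbT // geq_max size_polyC.
by rewrite (leq_trans (leq_b1 _)) // (leq_trans (size_scale_leq _ _)) ?size_polyX.
Qed.

Lemma coef_linear_exp (F : fieldType) (c y : F) e :
  ((c%:P + y *: 'X) ^+ e)`_e = y ^+ e.
Proof.
elim: e => [|e IH]; first by rewrite !expr0 coefC.
rewrite exprS mulrDl coefD coefCM -scalerAl coefZ coefXM /= IH -exprS.
by rewrite nth_default ?mulr0 ?add0r // size_linear_exp.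
Qed.

(** Look at the coefficient at the largest exponent [e i] with [a i * y i != 0]. Other summands are
    constant, zero or of smaller degree since [e] is injective, and [1 < e i] keeps [z0] and
    [z1 *: 'X] out of it. *)
Lemma sum_linear_powers (F : fieldType) (I : finType) (a c y : I -> F) (e : I -> nat)
    (z0 z1 : F) m :
  injective e -> (forall i, 1 < e i)%N -> (exists i, a i * y i != 0) ->
  (forall i, e i <= m)%N ->
  let P := \sum_i a i *: ((c i)%:P + y i *: 'X) ^+ e i - z0%:P - z1 *: 'X in
  P != 0 /\ (size P <= m.+1)%N.
Proof.
move=> e_inj e_gt1 [i0 i0P] le_em P; split; last first.
  have m_gt1 : (1 < m)%N by apply: leq_trans (le_em i0).
  have sB (p q : {poly F}) :
      (size p <= m.+1 -> size q <= m.+1 -> size (p - q)%R <= m.+1)%N.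
    by move=> sp sq; rewrite (leq_trans (size_polyD _ _)) // size_polyN geq_max sp.
  apply/sB; last by rewrite (leq_trans (size_scale_leq _ _)) ?size_polyX // ltnW.
  apply/sB; last by rewrite size_polyC (leq_trans (leq_b1 _)).
  apply: leq_trans (size_sum _ _ _) _.
  apply/bigmax_leqP => i _; apply: leq_trans (size_scale_leq _ _) _.
  by apply: leq_trans (size_linear_exp _ _ _) _; rewrite ltnS.
have [i ai imax] := @arg_maxnP _ i0 (fun i => a i * y i != 0) e i0P.
suff: P`_(e i) != 0 by apply: contraNneq => ->; rewrite coef0.
rewrite !coefB coefC coefZ coefX (gtn_eqF (e_gt1 i)) (gtn_eqF (ltnW (e_gt1 i))).
rewrite mulr0 !subr0 coef_sum (bigD1 i) //= big1 => [|i' ii'].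
  rewrite addr0 coefZ coef_linear_exp; move: ai; rewrite !mulf_eq0 !negb_or.
  by case/andP=> -> yi; rewrite expf_neq0.
rewrite coefZ; have [/eqP|ai'] := eqVneq (a i' * y i') 0.
  rewrite mulf_eq0 => /orP[/eqP->|/eqP->]; first by rewrite mul0r.
  by rewrite scale0r addr0 -polyC_exp coefC (gtn_eqF (ltnW (e_gt1 i))) mulr0.
have lt_e : (e i' < e i)%N.
  by rewrite ltn_neqAle (inj_eq e_inj) ii'; apply: imax.
by rewrite nth_default ?mulr0 // (leq_trans (size_linear_exp _ _ _)).
Qed.

Lemma powersum_eq0 (F : fieldType) (I : finType) (g : I -> F) k
    (a : 'rV[F]_k) (A : {set I}) :
  injective g -> (k <= #|A|)%N ->
  (forall p, p \in A -> \sum_j a 0 j * g p ^+ j = 0) -> a = 0.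
Proof.
move=> g_inj kA aA.
have hE x : (rVpoly a).[x] = \sum_j a 0 j * x ^+ j.
  rewrite (horner_coef_wide _ (size_poly k _)).
  by apply: eq_bigr => j _; rewrite coef_rVpoly_ord.
suff a0 : rVpoly a = 0 by rewrite -[a]rVpolyK a0 linear0.
apply/eqP; apply: contraTT kA => a0; rewrite -ltnNge.
have := @max_poly_roots _ (rVpoly a) [seq g p | p <- enum A] a0.
rewrite size_map -cardE map_inj_uniq // enum_uniq => sP.
apply: leq_trans (size_poly k _); apply: sP => //.
by apply/allP => t /mapP[p]; rewrite mem_enum => pA ->; rewrite /root hE aA.
Qed.

(** If the support had at most m points, the polynomial vanishing at all of them but [p0] would have
    degree < m. Orthogonality makes its pairing with [x] zero, yet only the nonzero term at [p0]
    survives. *)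
Lemma orthogonal_powers_support (F : fieldType) (I : finType) (g x : I -> F) m :
  injective g -> (forall t : 'I_m, \sum_p g p ^+ t * x p = 0) ->
  (exists p, x p != 0) -> (m < #|[set p | x p != 0%R]|)%N.
Proof.
move=> g_inj orth [p0 xp0]; rewrite ltnNge; apply/negP => small.
pose A := [set p | x p != 0] :\ p0.
pose P := \prod_(p <- enum A) ('X - (g p)%:P).
have sP : (size P <= m)%N.
  by rewrite size_prod_XsubC -cardE; move: small; rewrite (cardsD1 p0) inE xp0.
have : \sum_p P.[g p] * x p = 0.
  under eq_bigr do rewrite (horner_coef_wide _ sP) mulr_suml.
  rewrite exchange_big /= big1 // => t _.
  by under eq_bigr do rewrite -mulrA; rewrite -mulr_sumr orth mulr0.
rewrite (bigD1 p0) //= big1 ?addr0 => [/eqP|p pp0].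
  rewrite mulf_eq0 (negPf xp0) orbF -/(root P _) => rP.
  move: rP; rewrite /P -(big_map g xpredT (fun t => 'X - t%:P)) root_prod_XsubC.
  by case/mapP=> q; rewrite mem_enum !inE => /andP[/eqP qp0 _] /g_inj/esym.
have [->|xp] := eqVneq (x p) 0; first by rewrite mulr0.
suff /eqP-> : P.[g p] == 0 by rewrite mul0r.
rewrite -/(root P _) /P -(big_map g xpredT (fun t => 'X - t%:P)) root_prod_XsubC.
by rewrite map_f // mem_enum !inE pp0.
Qed.

Lemma card_bigcup_le (I T : finType) (A : {set I}) (f : I -> {set T}) m :
  (forall i, #|f i| <= m)%N -> (#|\bigcup_(i in A) f i| <= #|A| * m)%N.
Proof.
move=> fm; rewrite -sum_nat_const.
elim/big_rec2: _ => [|i B s _ sB]; first by rewrite cards0.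
by apply: leq_trans (leq_card_setU _ _) _; rewrite leq_add.
Qed.

(** This is the numerator of the sum of w_p / (t + g_p). It has degree < N, and at t = - g_p0 only
    the summand p0 remains, so it is nonzero. *)
Lemma card_poles_lt (F : finFieldType) N (g w : 'I_N -> F) :
  injective g -> (exists p, w p != 0) ->
  (#|[set t : F | (\sum_p w p * \prod_(p' in predC1 p) (t + g p') == 0)%R]| < N)%N.
Proof.
move=> g_inj [p0 wp0].
pose Q := \sum_p w p *: \prod_(p' in predC1 p) ('X - (- g p')%:P).
have QE t : Q.[t] = \sum_p w p * \prod_(p' in predC1 p) (t + g p').
  rewrite horner_sum; apply: eq_bigr => p _; rewrite hornerZ horner_prod.
  by congr (_ * _); apply: eq_bigr => p' _; rewrite !hornerE opprK.
have Q0 : Q != 0.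
  apply: contraNneq wp0 => Q0; have := QE (- g p0); rewrite Q0 horner0 (bigD1 p0) //=.
  have -> : \sum_(p | p != p0) w p * \prod_(p' in predC1 p) (- g p0 + g p') = 0.
    apply: big1 => p pp0.
    by rewrite (bigD1 p0) ?inE 1?eq_sym //= addNr mul0r mulr0.
  rewrite addr0 => /esym/eqP; rewrite mulf_eq0 => /orP[//|]; case/prodf_eq0=> p pp0.
  by rewrite addrC subr_eq0 (inj_eq g_inj) (negPf pp0).
have sQ : (size Q <= N)%N.
  apply: leq_trans (size_sum _ _ _) _; apply/bigmax_leqP => p _.
  apply: leq_trans (size_scale_leq _ _) _.
  rewrite -big_enum size_prod_XsubC -cardE cardC1 card_ord.
  by rewrite prednK // (leq_ltn_trans _ (ltn_ord p)).
apply: leq_trans sQ; apply: leq_trans (card_roots_lt Q0); rewrite ltnS.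
by apply/subset_leq_card/subsetP => t; rewrite !inE /root QE.
Qed.

(** * Coordinates on the spaces S_c *)

Section Family.
Variables (F : finFieldType) (gamma : F) (n k : nat).
Hypotheses (k_gt0 : (0 < k)%N) (lt_2k_n : (2 * k < n)%N) (le_nk_q : (n * k <= #|F|)%N).
Hypothesis gamma_prim : (#|F|.-1).-primitive_root gamma.

Local Notation N := (code_length n k).
Local Notation RS := (RS_code gamma n k).
Implicit Types (a b : 'rV[F]_k) (c d x w : 'rV[F]_N).

Definition gamma_part a x : 'rV[F]_N := a *m \matrix_j Gamma gamma j x.
Definition h_part a x : F := \sum_j a 0 j * h j x.

Lemma gamma_partE a x p :
  gamma_part a x 0 p = (\sum_j a 0 j * (gamma ^+ p.+1) ^+ j) * x 0 p.
Proof.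
rewrite mxE mulr_suml; apply: eq_bigr => j _.
by rewrite !mxE exprM mulrA.
Qed.

Lemma gamma_part_is_linear a : linear (gamma_part a).
Proof.
move=> s x y; apply/rowP => p; rewrite [RHS]mxE [X in _ = X + _]mxE !gamma_partE.
by rewrite [X in _ * X = _]mxE [X in _ * (X + _)]mxE; ring.
Qed.
HB.instance Definition _ a :=
  GRing.isLinear.Build F 'rV[F]_N 'rV[F]_N _ (gamma_part a) (gamma_part_is_linear a).

Lemma gamma_partZ s a x : gamma_part (s *: a) x = s *: gamma_part a x.
Proof. by rewrite /gamma_part -scalemxAl. Qed.

Lemma gamma_partD a b x : gamma_part (a + b) x = gamma_part a x + gamma_part b x.
Proof. by rewrite /gamma_part mulmxDl. Qed.

Lemma gamma_part0 x : gamma_part 0 x = 0.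
Proof. exact: mul0mx. Qed.

Lemma h_partZ s a x : h_part (s *: a) x = s * h_part a x.
Proof. by rewrite /h_part mulr_sumr; apply: eq_bigr => j _; rewrite mxE mulrA. Qed.

Lemma h_partD a b x : h_part (a + b) x = h_part a x + h_part b x.
Proof. by rewrite /h_part -big_split; apply: eq_bigr => j _; rewrite mxE mulrDl. Qed.

Lemma h_part0 x : h_part 0 x = 0.
Proof. by rewrite -(scale0r 0) h_partZ mul0r. Qed.

Definition encode a c : 'rV[F]_n := a *m \matrix_j generator gamma j c.

Lemma encodeE a c : encode a c =
  castmx (erefl 1, concat_length lt_2k_n)
    (row_mx a (row_mx (gamma_part a c) (h_part a c)%:M)).
Proof.
pose M := row_mx 1%:M (row_mx (\matrix_j Gamma gamma j c) (\col_j h j c)) :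
    'M_(k, k + (N + 1)).
have -> : encode a c = a *m castmx (erefl k, concat_length lt_2k_n) M.
  congr (_ *m _); apply/matrixP => j i.
  rewrite castmxE cast_ord_id mxE /generator.
  (* The lengths agree, so [conform_mx] returns the cast vector and not its default 0. *)
  rewrite -(conform_castmx (erefl 1, concat_length lt_2k_n)) conform_mx_id castmxE.
  rewrite !mxE /=; case: splitP => l _; first by rewrite !mxE !ord1 eqxx eq_sym.
  by rewrite !mxE; case: splitP => l' _; rewrite !mxE.
rewrite mulmx_castr !mul_mx_row mulmx1; congr (castmx _ (row_mx _ (row_mx _ _))).
rewrite [LHS]mx11_scalar mxE; congr (_%:M).
by apply: eq_bigr => j _; rewrite mxE.
Qed.

Lemma encode_eq a b c d : encode a c = encode b d ->
  [/\ a = b, gamma_part a c = gamma_part b d & h_part a c = h_part b d].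
Proof.
rewrite !encodeE => /(can_inj (castmxK _ _)).
move=> /eq_row_mx[-> /eq_row_mx[-> /matrixP/(_ 0 0)]].
by rewrite !mxE.
Qed.

Definition encode_hom c : 'Hom('rV[F]_k, 'rV[F]_n) :=
  linfun (mulmxr (\matrix_j generator gamma j c)).

Lemma encode_homE c a : encode_hom c a = encode a c.
Proof. by rewrite lfunE. Qed.

Lemma codeword_space_limg c : codeword_space gamma c = limg (encode_hom c).
Proof.
have -> : fullv = <<[seq (delta_mx 0%R j : 'rV[F]_k) | j : 'I_k]>>%VS.
  apply/vspaceP => a; rewrite memvf [a]row_sum_delta; apply/esym.
  by apply: memv_suml => j _; apply/memvZ/memv_span/image_f.
rewrite limg_span -map_comp; congr (<<_>>)%VS.
by apply: eq_map => j /=; rewrite encode_homE /encode -rowE rowK.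
Qed.

Lemma codeword_spaceP c v :
  reflect (exists a, v = encode a c) (v \in codeword_space gamma c).
Proof.
rewrite codeword_space_limg.
apply: (iffP memv_imgP) => [[a _ ->]|[a ->]]; exists a; rewrite ?memvf //.
  by rewrite encode_homE.
by rewrite encode_homE.
Qed.

Lemma dim_codeword_space c : \dim (codeword_space gamma c) = k.
Proof.
rewrite codeword_space_limg limg_dim_eq ?dimvf ?dim_matrix; first exact: mul1n.
apply/vspaceP => a; rewrite memv_cap memv_ker memvf encode_homE memv0 /=.
apply/eqP/eqP => [ac0|->]; last by rewrite /encode mul0mx.
by have [] : [/\ a = 0, _ & _] := @encode_eq a 0 c c (etrans ac0 (esym (mul0mx _ _))).
Qed.

(** * The Reed-Solomon code and the partial spread *)

Lemma le_k_code_length : (k <= N)%N.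
Proof. rewrite /code_length; lia. Qed.

(** The exponents differ by less than N < q - 1, the order of gamma. The nodes of the parity check
    are the case i = 0, the multipliers of [Gamma] the case i = 1. *)
Lemma powers_inj i : (i <= 1)%N -> injective (fun p : 'I_N => gamma ^+ (p + i)).
Proof.
move=> i1 p p' /eqP; rewrite (eq_prim_root_expr gamma_prim) eqn_modDr => /eqP.
have lt_q (r : 'I_N) : (r < #|F|.-1)%N.
  have := leq_pmulr n k_gt0; have := ltn_ord r; rewrite /code_length; lia.
by rewrite !modn_small // => /val_inj.
Qed.

Lemma points_inj : injective (fun p : 'I_N => gamma ^+ p.+1).
Proof. by move=> p p'; have := @powers_inj 1 (leqnn 1) p p'; rewrite !addn1. Qed.

Lemma RS_codeE x : (x \in RS) = (x *m (parity_check gamma n k)^T == 0).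
Proof. by rewrite inE -trmx_eq0 trmx_mul trmxK. Qed.

Lemma RS_codeB c d : c \in RS -> d \in RS -> c - d \in RS.
Proof. by rewrite !RS_codeE mulmxBl => /eqP-> /eqP->; rewrite subr0. Qed.

Lemma RS_codeZ s c : c \in RS -> s *: c \in RS.
Proof. by rewrite !RS_codeE -scalemxAl => /eqP->; rewrite scaler0. Qed.

Lemma RS_min_distance x : x \in RS -> x != 0 -> (k <= #|[set p | x 0%R p != 0%R]|)%N.
Proof.
rewrite inE => /eqP xP /rV0Pn x0.
suff : (k - 1 < #|[set p | x 0%R p != 0%R]|)%N by rewrite subn1 prednK.
apply: orthogonal_powers_support (powers_inj (leq0n 1)) _ x0 => t.
move/matrixP/(_ t 0): xP; rewrite !mxE => xt; rewrite -[RHS]xt; apply: eq_bigr => p _.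
by rewrite !mxE addn0 exprM.
Qed.

(** On the support of x, which has at least k points if x != 0, the polynomial with coefficients a
    would have to vanish. *)
Lemma gamma_part_eq0 a x : x \in RS -> a != 0 -> gamma_part a x = 0 -> x = 0.
Proof.
move=> xRS a0 ax; apply: contraNeq a0 => /(RS_min_distance xRS) wt; apply/eqP.
apply: (powersum_eq0 points_inj wt) => p; rewrite inE => xp.
move/rowP/(_ p)/eqP: ax; rewrite gamma_partE mxE mulf_eq0 (negPf xp) orbF.
by move/eqP.
Qed.

Lemma encode_eq_codeword a b c d : c \in RS -> d \in RS -> a != 0 ->
  encode a c = encode b d -> c = d.
Proof.
move=> cRS dRS a0 /encode_eq[<- /eqP + _].
rewrite -subr_eq0 -linearB => /eqP /(gamma_part_eq0 (RS_codeB cRS dRS) a0) /eqP.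
by rewrite subr_eq0 => /eqP.
Qed.

Lemma codeword_space_trivI c d : c \in RS -> d \in RS -> c != d ->
  (codeword_space gamma c :&: codeword_space gamma d = 0)%VS.
Proof.
move=> cRS dRS cd; apply/eqP; rewrite -subv0; apply/subvP => v.
rewrite memv_cap memv0 => /andP[/codeword_spaceP[a ->] /codeword_spaceP[b]].
have [->|a0] := eqVneq a 0; first by rewrite /encode mul0mx.
by move=> /(encode_eq_codeword cRS dRS a0) cdE; rewrite cdE eqxx in cd.
Qed.

Lemma codeword_space_inj : {in RS &, injective (@codeword_space F gamma n k)}.
Proof.
move=> c d cRS dRS cdE; apply/eqP; apply: contraT => /(codeword_space_trivI cRS dRS).
rewrite cdE capvv => /(congr1 (fun V => \dim V)).
by rewrite dim_codeword_space dimv0 => k0; have := k_gt0; rewrite k0.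
Qed.

(** The k - 1 rows of the parity check are independent, since a polynomial of degree < k - 1 cannot
    vanish at N >= k nodes; the kernel has dimension N - (k - 1) = n - 2 k. *)
Lemma card_RS_code : #|RS| = (#|F| ^ (n - 2 * k))%N.
Proof.
pose P := (parity_check gamma n k)^T.
have -> : RS = rowg (kermx P).
  by apply/setP => x; rewrite RS_codeE mem_rowg; apply/eqP/sub_kermxP.
rewrite card_rowg mxrank_ker; congr (_ ^ _)%N.
suff -> : \rank P = (k - 1)%N by rewrite /code_length; lia.
rewrite mxrank_tr; apply/eqP/inj_row_free => a aP.
apply: (powersum_eq0 (A := setT) (powers_inj (leq0n 1))).
  by have := le_k_code_length; rewrite cardsT card_ord; lia.
move=> p _; move/rowP/(_ p): aP; rewrite !mxE => ap; rewrite -[RHS]ap {ap}.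
by apply: eq_bigr => t _; rewrite mxE addn0 exprM.
Qed.

Lemma card_AAD_family : #|` AAD_family gamma n k| = (#|F| ^ (n - 2 * k))%N.
Proof.
rewrite /AAD_family card_in_imfset /=; last exact: codeword_space_inj.
by rewrite -card_RS_code -cardE.
Qed.

Lemma partial_spread_AAD_family : partial_spread k (AAD_family gamma n k).
Proof.
split=> [S /imfsetP[c /= _ ->]|]; first exact: dim_codeword_space.
move=> S T /imfsetP[c /= cRS ->] /imfsetP[d /= dRS ->] ST.
by apply: codeword_space_trivI => //; apply: contraNneq ST => ->.
Qed.

(** * Counting the spaces met by a translate *)

(** The pair (w, z) is what remains of u after subtracting the vector of S_c with the same first k
    coordinates; a lists the coefficients of the common point in S_d. *)
Lemma affine_meets_encode c u : u \notin codeword_space gamma c ->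
  exists w z, (w != 0) || (z != 0) /\
  forall d, affine_meets u (codeword_space gamma c) (codeword_space gamma d) ->
    exists a, w = gamma_part a (d - c) /\ z = h_part a d - h_part a c.
Proof.
move=> uc; pose e := concat_length lt_2k_n.
pose u' : 'rV_(k + (N + 1)) := castmx (erefl 1, esym e) u.
have uE : u = castmx (erefl 1, e) u' by rewrite castmxKV.
pose u0 := lsubmx u'; pose w1 := lsubmx (rsubmx u'); pose z1 := rsubmx (rsubmx u') 0 0.
have u'E : u' = row_mx u0 (row_mx w1 z1%:M) by rewrite -mx11_scalar !hsubmxK.
exists (w1 - gamma_part u0 c), (z1 - h_part u0 c); split.
  apply: contraNT uc; rewrite negb_or !negbK !subr_eq0 => /andP[/eqP w1E /eqP z1E].
  by apply/codeword_spaceP; exists u0; rewrite encodeE uE u'E w1E z1E.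
move=> d /existsP[v /andP[/codeword_spaceP[a ->] /codeword_spaceP[b]]].
rewrite !encodeE uE -castmxD u'E !add_row_mx => /(can_inj (castmxK _ _)).
move=> /eq_row_mx[bE /eq_row_mx[wE /matrixP/(_ 0 0)]].
rewrite !mxE eqxx !mulr1n => zE; exists b.
rewrite linearB /= -wE -zE -bE gamma_partD h_partD; split; last by ring.
by apply/rowP => p; rewrite !mxE; ring.
Qed.

Lemma parameter_neq0 a c d w z : (w != 0) || (z != 0) ->
  w = gamma_part a (d - c) -> z = h_part a d - h_part a c -> a != 0.
Proof.
move=> wz wE zE; apply: contraTneq wz => a0.
rewrite wE zE a0 gamma_part0 !h_part0 subrr.
by rewrite !eqxx.
Qed.

(** If w = 0, injectivity of [gamma_part a] gives d = c, and then z = 0 as well. *)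
Lemma offset_neq0 a c d w z : c \in RS -> d \in RS -> (w != 0) || (z != 0) ->
  w = gamma_part a (d - c) -> z = h_part a d - h_part a c -> w != 0.
Proof.
move=> cRS dRS wz wE zE; have a0 := parameter_neq0 wz wE zE.
apply: contraTneq wz => w0; rewrite w0 eqxx /= zE.
have /eqP := gamma_part_eq0 (RS_codeB dRS cRS) a0 (esym (etrans (esym w0) wE)).
by rewrite subr_eq0 => /eqP->; rewrite subrr eqxx.
Qed.

Definition direction_set b c w z : {set 'rV[F]_N} :=
  [set d in RS | [exists s, (w == gamma_part (s *: b) (d - c)) &&
                            (z == h_part (s *: b) d - h_part (s *: b) c)]].

(* The polynomial P below is nonzero because the exponents occurring in the h_j
   are pairwise distinct, so its top monomials cannot cancel. *)
Lemma card_direction_set b c w z : b != 0 -> c \in RS -> (w != 0) || (z != 0) ->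
  (#|direction_set b c w z| <= k * N + 1)%N.
Proof.
move=> b0 cRS wz; have [->|[d0]] := set_0Vmem (direction_set b c w z).
  by rewrite cards0.
rewrite inE => /andP[d0RS /existsP[s0 /andP[/eqP wE0 /eqP zE0]]].
(* By injectivity, y does not depend on the choice of [d0]: each d of the set satisfies d - c = s^-1
   y. Multiplying the equation for z by t = s^-1 makes it the polynomial equation P(t) = 0. *)
pose y := s0 *: (d0 - c); have yRS : y \in RS by apply/RS_codeZ/RS_codeB.
have wEy : w = gamma_part b y by rewrite linearZ wE0 gamma_partZ.
have y0 : y != 0.
  have w0 := offset_neq0 cRS d0RS wz wE0 zE0.
  by apply: contraNneq w0 => y0; rewrite wEy y0 linear0.
pose a (i : 'I_k * 'I_N) := b 0 i.1.
pose e (i : 'I_k * 'I_N) := (i.1 * N + i.2.+1 + 1)%N.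
pose P :=
  \sum_i a i *: ((c 0 i.2)%:P + y 0 i.2 *: 'X) ^+ e i - (h_part b c)%:P - z *: 'X.
have hE t : P.[t] = h_part b (c + t *: y) - h_part b c - z * t.
  rewrite /P !hornerE; congr (_ - _ - _).
  rewrite horner_sum /h_part.
  under [RHS]eq_bigr do rewrite /h mulr_sumr.
  rewrite pair_big /=; apply: eq_bigr => i _.
  by rewrite !hornerE !mxE [t * _]mulrC.
have [P0 sP] : P != 0 /\ (size P <= (k * N + 1).+1)%N.
  apply: sum_linear_powers.
  (* Division by N recovers j and p from the exponent j N + p + 2. *)
  - move=> [j p] [j' p']; rewrite /e /= !addn1 !addnS => -[] jp.
    have N0 : (0 < N)%N by apply: leq_ltn_trans (ltn_ord p).
    have eqj : j = j'.
      apply/val_inj; have := congr1 (divn^~ N) jp.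
      by rewrite /= !divnMDl // !divn_small // !addn0.
    by move: jp; rewrite eqj => /addnI/val_inj->.
  - by move=> [j p]; rewrite /e addn1 addnS.
  - case/rV0Pn: b0 => j bj; case/rV0Pn: y0 => p yp.
    by exists (j, p); rewrite mulf_neq0.
  - case=> [[j lej] p]; rewrite /e /= leq_add2r.
    apply: leq_trans (_ : j * N + N <= _)%N; first by rewrite leq_add2l.
    by rewrite addnC -mulSn leq_mul2r lej orbT.
pose line := [set c + t *: y | t in [set t | root P t]].
apply: (@leq_trans #|line|); last first.
  apply: leq_trans (leq_imset_card _ _) _.
  by rewrite -ltnS (leq_trans (card_roots_lt P0)).
apply/subset_leq_card/subsetP => d.
rewrite inE => /andP[dRS /existsP[s /andP[/eqP wE /eqP zE]]].
have s_neq0 : s != 0.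
  by have := parameter_neq0 wz wE zE; apply: contraNneq => ->; rewrite scale0r.
have dE : d - c = s^-1 *: y.
  apply: (canRL (scalerK s_neq0)); apply/eqP; rewrite -subr_eq0; apply/eqP.
  apply: (gamma_part_eq0 _ b0); first by apply: RS_codeB => //; apply/RS_codeZ/RS_codeB.
  by rewrite linearB linearZ /= -wEy wE gamma_partZ subrr.
have dE' : d = c + s^-1 *: y by rewrite -dE addrC subrK.
apply/imsetP; exists s^-1 => //; rewrite inE /root hE -dE' zE !h_partZ -mulrBr.
by rewrite mulrC mulKf // subrr.
Qed.

Lemma card_fset_meets_le (S : {vspace 'rV[F]_n}) u :
  (#|` [fset T in AAD_family gamma n k | affine_meets u S T]%fset|
   <= #|[set d in RS | affine_meets u S (codeword_space gamma d)]|)%N.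
Proof.
set D := [set d in RS | _].
apply: leq_trans (_ : #|` [fset codeword_space gamma d | d in D]%fset| <= _)%N.
  apply/fsubset_leq_card/fsubsetP => T.
  rewrite !inE /= => /andP[/imfsetP[d /= dRS ->] ud].
  by apply/imfsetP; exists d; rewrite //= inE dRS.
by rewrite (leq_trans (leq_imfset_card _ _ _)) // -cardE.
Qed.

(** The set [A] of admissible directions depends on w alone, so the codewords met lie in a union of
    at most m sets [direction_set]. *)
Lemma almost_affinely_disjoint_directions (I : finType) (b : I -> 'rV[F]_k) m L :
  (forall i, b i != 0) ->
  (forall w, w != 0 -> exists2 A : {set I}, (#|A| <= m)%N &
     forall x a, x \in RS -> w = gamma_part a x ->
       exists2 i, i \in A & exists s, a = s *: b i) ->
  (m * (k * N + 1) <= L)%N ->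
  almost_affinely_disjoint k L (AAD_family gamma n k).
Proof.
move=> b0 bP mL; split=> [|_ u /imfsetP[c /= cRS ->] uc].
  exact: partial_spread_AAD_family.
apply: leq_trans (card_fset_meets_le _ u) _; set D := [set d in RS | _].
have [w [z [wz meetP]]] := affine_meets_encode uc.
(* As soon as one space is met, w != 0 and the hypothesis on directions applies. *)
have [->|[d0]] := set_0Vmem D; first by rewrite cards0.
rewrite inE => /andP[d0RS /meetP[a0 [wE0 zE0]]].
have [A Am AP] := bP w (offset_neq0 cRS d0RS wz wE0 zE0).
apply: leq_trans mL; apply: leq_trans (leq_mul Am (leqnn _)).
apply: leq_trans (card_bigcup_le A (fun i => card_direction_set (b0 i) cRS wz)).
apply/subset_leq_card/subsetP => d; rewrite inE => /andP[dRS /meetP[a [wE zE]]].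
have [i iA [s aE]] := AP _ _ (RS_codeB dRS cRS) wE.
apply/bigcupP; exists i => //; rewrite inE dRS; apply/existsP; exists s.
by rewrite -aE -wE -zE !eqxx.
Qed.

End Family.

(** * The cases k = 1 and k = 2 *)

Lemma AAD_family1 (F : finFieldType) n (gamma : F) :
  (2 * 1 < n)%N -> (n * 1 <= #|F|)%N -> (#|F|.-1).-primitive_root gamma ->
  almost_affinely_disjoint 1 (n - 1) (AAD_family gamma n 1).
Proof.
move=> lt2n le_nq gP.
apply: (@almost_affinely_disjoint_directions F gamma n 1 _ _ _ _
  unit (fun=> const_mx 1) 1) => //.
- by move=> _; apply/rV0Pn; exists 0; rewrite mxE oner_eq0.
- move=> w _; exists [set tt]; first by rewrite cards1.
  move=> x a _ _; exists tt; rewrite ?inE //; exists (a 0 0).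
  by apply/rowP => j; rewrite !mxE mulr1 ord1.
- rewrite /code_length; lia.
Qed.

Lemma AAD_family2 (F : finFieldType) n (gamma : F) :
  (2 * 2 < n)%N -> (n * 2 <= #|F|)%N -> (#|F|.-1).-primitive_root gamma ->
  almost_affinely_disjoint 2 (1 + 2 * (n - 2) * (2 * n - 5)) (AAD_family gamma n 2).
Proof.
move=> lt2n le_nq gP.
(* [Some t] is the direction (t, 1), and [None] is the point at infinity (1, 0). *)
pose b (o : option F) : 'rV[F]_2 :=
  if o is Some t then \row_j (if j == 0 then t else 1) else delta_mx 0 0.
apply: (@almost_affinely_disjoint_directions F gamma n 2 _ _ _ _
  (option F) b (code_length n 2)) => //.
- case=> [t|]; apply/rV0Pn; first by exists 1; rewrite mxE oner_eq0.
  by exists 0; rewrite mxE oner_eq0.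
- move=> w /rV0Pn w0.
  pose g (p : 'I_(code_length n 2)) := gamma ^+ p.+1.
  pose T := [set t | \sum_p w 0 p * \prod_(p' in predC1 p) (t + g p') == 0].
  have g_inj : injective g by apply: points_inj.
  (* The strict bound on [T] leaves room for [None] within N. *)
  exists (None |: Some @: T).
    apply: leq_trans (leq_card_setU _ _) _; rewrite cards1 add1n.
    exact: leq_ltn_trans (leq_imset_card _ _) (card_poles_lt g_inj w0).
  move=> x a xRS wE; have [a1|a1] := eqVneq (a 0 1) 0.
    exists None; first by rewrite !inE eqxx.
    exists (a 0 0); apply/rowP => j; rewrite !mxE /=; case: j => [[|[|//]] lt_j] /=.
      by rewrite mulr1; congr (a _ _); apply/val_inj.
    by rewrite mulr0 -[RHS]a1; congr (a _ _); apply/val_inj.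
  exists (Some (a 0 0 / a 0 1)); last first.
    exists (a 0 1); apply/rowP => j; rewrite !mxE; case: j => [[|[|//]] lt_j] /=.
      by rewrite mulrC divfK //; congr (a _ _); apply/val_inj.
    by rewrite mulr1; congr (a _ _); apply/val_inj.
  rewrite inE; apply/orP; right; apply: imset_f; rewrite inE; apply/eqP.
  set t := a 0 0 / a 0 1.
  (* For k = 2 the only row of the parity check is all ones. *)
  have x0 : \sum_p x 0 p = 0.
    move: xRS; rewrite inE => /eqP/matrixP/(_ 0 0); rewrite !mxE => xs.
    rewrite -[RHS]xs.
    by apply: eq_bigr => p _; rewrite !mxE muln0 expr0 mul1r.
  (* Here w_p = a_1 (t + g_p) x_p with a_1 = [a 0 1], which supplies the factor missing from the
     product. *)
  transitivity (\sum_p a 0 1 * \prod_p' (t + g p') * x 0 p).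
    apply: eq_bigr => p _; rewrite [X in _ = _ * X * _](bigD1 p) //=.
    rewrite wE gamma_partE big_ord_recl big_ord1 -/(g p).
    have -> : lift 0 0 = 1 :> 'I_2 by apply/val_inj.
    rewrite expr0 expr1 mulr1; have -> : a 0 0 = a 0 1 * t by rewrite mulrC divfK.
    by ring.
  by rewrite -mulr_sumr x0 mulr0.
(* The count (n - 3)(2 n - 5) lies below the stated bound. *)
- rewrite /code_length; nia.
Qed.

Theorem theorem3 (F : finFieldType) (k n : nat) (gamma : F)
    (k_gt0 : (0 < k)%N) (lt_2k_n : (2 * k < n)%N)
    (le_nk_q : (n * k <= #|F|)%N)
    (gamma_prim : (#|F|.-1).-primitive_root gamma) :
  [/\ #|` AAD_family gamma n k| = (#|F| ^ (n - 2 * k))%N,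
      partial_spread k (AAD_family gamma n k),
      k = 1%N -> almost_affinely_disjoint k (n - 1) (AAD_family gamma n k)
    & k = 2%N -> almost_affinely_disjoint k (1 + 2 * (n - 2) * (2 * n - 5))
                   (AAD_family gamma n k)].
Proof.
split; first exact: card_AAD_family; first exact: partial_spread_AAD_family.
- by move=> k1; subst k; apply: AAD_family1.
- by move=> k2; subst k; apply: AAD_family2.
Qed.
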